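(* Assume (A.1) and (A.2). Then $$\sup_{\beta\in(0,1)}\|w^\beta(\cdot,\gamma)-w^\beta(\cdot,0)\|_{\mathrm{sp}}\to0\quad\text{as }\gamma\to0.$$
   Context: Setting (finite discounted risk-sensitive MDP). $E=\{x_1,\dots,x_k\}$ is a finite state space and $U=\{\tilde u_1,\dots,\tilde u_l\}$ a finite action space (both nonempty); every action is available in every state. For $a\in U$, $P^a=[p_a(x_i,x_j)]$ is a transition probability matrix and $\mathbb{P}^a(x,A):=\sum_{y\in A}p_a(x,y)$ for $A\subset E$. $c\colon E\times U\to\mathbb{R}$ is a fixed running reward. $(X_n)_{n\ge0}$ is the state process. A policy is a sequence $\pi=(a_n)_{n\ge0}$, $a_n$ a $U$-valued function of $(X_0,\dots,X_n)$; $\Pi$ is the set of all policies. $\mathbb{E}_x^\pi$ is expectation under the law with $X_0=x$ and $\mathbb{P}(X_{n+1}=y\mid X_0,\dots,X_n)=p_{a_n}(X_n,y)$. $\Pi''\subset\Pi$ is the set of Markov policies: $a_n=u_n(X_n)$ with $u_n\colon E\to U$. $\mathbb{P}^{(\pi,n)}(x,y)$ is the probability under $\pi$ that $X_n=y$ given $X_0=x$. Value function: for $\beta\in(0,1)$, $w^\beta(x,\gamma):=\sup_{\pi\in\Pi}\frac1\gamma\ln\mathbb{E}_x^\pi\big[e^{\gamma\sum_{i=0}^\infty\beta^ic(X_i,a_i)}\big]$ if $\gamma\ne0$, and $w^\beta(x,0):=\sup_{\pi\in\Pi}\mathbb{E}_x^\pi\big[\sum_{i=0}^\infty\beta^ic(X_i,a_i)\big]$.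 Assumptions. (A.1) $\overline\Delta:=\sup_{x,x'\in E}\sup_{A\subset E}\sup_{a,a'\in U}|\mathbb{P}^a(x,A)-\mathbb{P}^{a'}(x',A)|<1$. (A.2) There exists $N\in\mathbb{N}$ such that $K:=\sup_{x,x'\in E}\sup_{y\in E}\sup_{\pi\in\Pi''}\frac{\mathbb{P}^{(\pi,N)}(x,y)}{\mathbb{P}^{(\pi,N)}(x',y)}<\infty$, with conventions $0/0:=1$ and $p/0:=\infty$ for $p>0$. Span semi-norm: $\|f\|_{\mathrm{sp}}:=\sup_{x,y\in E}[f(x)-f(y)]$ for $f\colon E\to\mathbb{R}$. *)

(* Defs.v *)
From HB Require Import structures.
From mathcomp Require Import all_boot all_order all_algebra.
From mathcomp Require Import all_classical all_reals all_analysis.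

Set Implicit Arguments.
Unset Strict Implicit.
Unset Printing Implicit Defensive.

Import Order.TTheory GRing.Theory Num.Theory.
Import numFieldNormedType.Exports.

Local Open Scope classical_set_scope.
Local Open Scope ring_scope.

Definition transition_kernel (R : realType) (E U : finType)
    (p : U -> E -> E -> R) : Prop :=
  (forall a x y, 0 <= p a x y) /\ (forall a x, \sum_y p a x y = 1).

(* The action at time [n] depends on the whole history [(X_0, ..., X_n)]. *)
Definition policy (E U : finType) : Type := forall n : nat, n.+1.-tuple E -> U.

Definition is_markov (E U : finType) (pi : policy E U) : Prop :=
  exists u : nat -> E -> U, forall n (h : n.+1.-tuple E),
    pi n h = u n (tnth h ord_max).

Definition history (E : finType) (Omega : Type) (X : nat -> Omega -> E)
    (n : nat) (omega : Omega) : n.+1.-tuple E :=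
  [tuple X i omega | i < n.+1].

Definition action (E U : finType) (Omega : Type) (X : nat -> Omega -> E)
    (pi : policy E U) (n : nat) (omega : Omega) : U :=
  pi n (history X n omega).

(* [Pr pi x] is the law under which the process [X] starts at [x] and is
   controlled by [pi]. The last clause says that, given
   [(X_0, ..., X_n) = h], the next state is distributed according to
   [p_{a_n}(X_n, .)]; in product form it puts no constraint on null histories. *)
Record controlled_process (R : realType) (E U : finType)
    (p : U -> E -> E -> R) (d : measure_display) (Omega : measurableType d)
    (X : nat -> Omega -> E)
    (Pr : policy E U -> E -> probability Omega R) : Prop := ControlledProcess {
  process_measurable : forall n y, measurable (X n @^-1` [set y]) ;
  process_initial : forall pi x, Pr pi x (X 0%N @^-1` [set x]) = 1%:E ;
  process_transition : forall pi x n (h : n.+1.-tuple E) y,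
    Pr pi x (history X n @^-1` [set h] `&` X n.+1 @^-1` [set y]) =
    (Pr pi x (history X n @^-1` [set h]) * (p (pi n h) (tnth h ord_max) y)%:E)%E
}.

Definition total_reward (R : realType) (E U : finType) (c : E -> U -> R)
    (Omega : Type) (X : nat -> Omega -> E) (beta : R) (pi : policy E U)
    (omega : Omega) : R :=
  limn (series (fun i => beta ^+ i * c (X i omega) (action X pi i omega))).

Definition value (R : realType) (E U : finType) (c : E -> U -> R)
    (d : measure_display) (Omega : measurableType d) (X : nat -> Omega -> E)
    (Pr : policy E U -> E -> probability Omega R) (beta gamma : R) (x : E) : R :=
  if gamma == 0 then
    sup [set fine ('E_(Pr pi x)[total_reward c X beta pi])%E
        | pi in [set: policy E U]]
  else
    sup [set gamma^-1 * ln (fine ('E_(Pr pi x)[fun omega =>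
                  expR (gamma * total_reward c X beta pi omega)])%E)
        | pi in [set: policy E U]].

Definition span_seminorm (R : realType) (E : finType) (f : E -> R) : R :=
  sup [set f xy.1 - f xy.2 | xy in [set: E * E]].

Definition trans_prob (R : realType) (E U : finType) (p : U -> E -> E -> R)
    (a : U) (x : E) (A : {set E}) : R :=
  \sum_(y in A) p a x y.

Definition Delta_bar (R : realType) (E U : finType) (p : U -> E -> E -> R) : R :=
  sup [set r | exists (x x' : E) (A : {set E}) (a a' : U),
    r = `|trans_prob p a x A - trans_prob p a' x' A|].

Definition nstep_prob (R : realType) (E U : finType) (d : measure_display)
    (Omega : measurableType d) (X : nat -> Omega -> E)
    (Pr : policy E U -> E -> probability Omega R) (pi : policy E U) (n : nat)
    (x y : E) : R :=
  fine (Pr pi x (X n @^-1` [set y])).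

(* Ratio of probabilities with the conventions 0/0 = 1 and p/0 = +oo. *)
Definition prob_ratio (R : realType) (r s : R) : \bar R :=
  if s != 0 then (r / s)%:E else if r == 0 then 1%:E else +oo%E.

Definition ratio_bound (R : realType) (E U : finType) (d : measure_display)
    (Omega : measurableType d) (X : nat -> Omega -> E)
    (Pr : policy E U -> E -> probability Omega R) (n : nat) : \bar R :=
  ereal_sup [set r | exists (x x' y : E) (pi : policy E U), is_markov pi /\
    r = prob_ratio (nstep_prob X Pr pi n x y) (nstep_prob X Pr pi n x' y)].

Definition assumption_A1 (R : realType) (E U : finType)
    (p : U -> E -> E -> R) : Prop :=
  Delta_bar p < 1.

Definition assumption_A2 (R : realType) (E U : finType) (d : measure_display)
    (Omega : measurableType d) (X : nat -> Omega -> E)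
    (Pr : policy E U -> E -> probability Omega R) : Prop :=
  exists N : nat, (ratio_bound X Pr N < +oo)%E.

(* Main.v *)
Require Import Defs.
From HB Require Import structures.
From mathcomp Require Import all_boot all_order all_algebra.
From mathcomp Require Import all_classical all_reals all_analysis.
From mathcomp Require Import measurable_realfun ring lra.

(** Write [V_n(gamma, x)] for the optimal risk-sensitive reward over [n] steps.
Conditioning on the first transition gives the dynamic programming recursion
[V_{n+1}(gamma, x) = max_a (c(x, a) + beta * rho_{gamma beta}(V_n(gamma beta, .)))],
where [rho_g] is the entropic functional [g^-1 ln E e^{g .}] under [p_a(x, .)],
and the mean when [g = 0]: a discounted problem with risk parameter [gamma] is,
after one step, a problem with the smaller parameter [gamma * beta].

Two estimates compare the recursions for [gamma] and for [0].
- If [f] oscillates by at most [s] and [|g| s <= 1/2], then [rho_g(f)] is within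
  [2 |g| s^2] of the mean of [f] ([entropic_mean]).
- For two rows of the transition matrices, the means of [f] differ by at most
  [Delta_bar] times the oscillation of [f] ([mean_contract]).
The second estimate bounds the oscillation of [V_n(0, .)] by
[2 ||c|| / (1 - Delta_bar)], for all [n] and [beta] ([osc_neutral]). Together
they show that if [V_n(gamma beta, .) - V_n(0, .)] oscillates by at most [eps],
then [V_{n+1}(gamma, .) - V_{n+1}(0, .)] oscillates by at most
[Delta_bar * eps + O(|gamma|)], where the constant in [O] depends neither on
[beta] nor on [n]. Since [Delta_bar < 1], this is again at most [eps] as soon as
[gamma] is small, and induction on [n] applies because [|gamma beta| <= |gamma|]
([osc_compare]). Only the mean has to contract; no contraction property of
[rho_g] itself enters.

The rest links [V_n] to the controlled process. The law of the history is
computed step by step from the transition probabilities, so that the certainty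
equivalent of the truncated reward under a policy satisfies the same recursion
with the chosen action in place of the maximum ([certainty_equiv_partial]).
Truncating the reward after [n] steps moves it uniformly by at most
[||c|| beta^n / (1 - beta)], hence moves the value by no more than that
([value_horizon]); letting [n] tend to infinity for fixed [beta] transfers the
oscillation bound to the value functions ([osc_value]). *)

Set Implicit Arguments.
Unset Strict Implicit.
Unset Printing Implicit Defensive.

Import Order.TTheory GRing.Theory Num.Theory.
Import numFieldNormedType.Exports.

Local Open Scope classical_set_scope.
Local Open Scope ring_scope.

(** * Mean and entropic functionals of a distribution on a finite set *)

Section Entropic.
Variables (R : realType) (E : finType).
Implicit Types (q f g : E -> R) (gamma s : R).

Definition mean q f : R := \sum_y q y * f y.

Definition stochastic q := (forall y, 0 <= q y) /\ \sum_y q y = 1.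

Definition entropic gamma q f : R :=
  if gamma == 0 then mean q f
  else gamma^-1 * ln (mean q (fun y => expR (gamma * f y))).

Definition osc_le f s := forall x y, f x - f y <= s.

Lemma le_mean q f g : stochastic q -> (forall y, f y <= g y) ->
  mean q f <= mean q g.
Proof. by move=> [q0 _] fg; apply: ler_sum => y _; exact: ler_wpM2l. Qed.

Lemma mean_affine q a b f : stochastic q ->
  mean q (fun y => a + b * f y) = a + b * mean q f.
Proof.
move=> [_ q1]; rewrite /mean mulr_sumr -[a in RHS]mul1r -q1 mulr_suml -big_split.
by apply: eq_bigr => y _ /=; ring.
Qed.

Lemma mean_cst q a : stochastic q -> mean q (fun=> a) = a.
Proof.
move=> qs; rewrite (_ : (fun=> a) = (fun y => a + 0 * a)) ?mean_affine//; first ring.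
by apply/funext => y; ring.
Qed.

Lemma meanB q f g : mean q f - mean q g = mean q (fun y => f y - g y).
Proof. by rewrite /mean -sumrB; apply: eq_bigr => y _; ring. Qed.

Lemma mean_gt0 q f : stochastic q -> (forall y, 0 < f y) -> 0 < mean q f.
Proof.
move=> [q0 q1] f0; have [y _ qy] : exists2 y, true & 0 < q y.
  apply/exists_inP; apply: contraT => /exists_inPn qn.
  have := oner_neq0 R; rewrite -q1 big1 ?eqxx// => y _.
  by apply/eqP; rewrite eq_le q0 andbT leNgt; exact: qn.
rewrite /mean (bigD1 y)//= ltr_pwDl ?mulr_gt0//.
by apply: sumr_ge0 => z _; rewrite mulr_ge0// ltW.
Qed.

(** The factor [gamma^-1] reverses the order exactly when the exponential of
    [gamma] times a reward does, so certainty equivalents are monotone for both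
    signs of [gamma]. *)
Lemma ler_ln_scale gamma a b : gamma != 0 -> 0 < a -> 0 < b ->
  (0 < gamma -> a <= b) -> (gamma < 0 -> b <= a) ->
  gamma^-1 * ln a <= gamma^-1 * ln b.
Proof.
move=> g0 a0 b0 abp abn; case: (ltgtP gamma 0) g0 => // gs _.
  by rewrite ler_wnM2l ?ler_ln ?posrE ?abn// invr_le0 ltW.
by rewrite ler_wpM2l ?ler_ln ?posrE ?abp// invr_ge0 ltW.
Qed.

Lemma le_entropic gamma q f g : stochastic q -> (forall y, f y <= g y) ->
  entropic gamma q f <= entropic gamma q g.
Proof.
move=> qs fg; rewrite /entropic; case: eqVneq => [_|g0]; first exact: le_mean.
have pos h : 0 < mean q (fun y => expR (gamma * h y)).
  by apply: mean_gt0 => // y; exact: expR_gt0.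
apply: ler_ln_scale => // gs; apply: le_mean => // y; rewrite ler_expR.
  by rewrite ler_pM2l.
by rewrite ler_nM2l.
Qed.

(** From [exp (- x) >= 1 - x] one gets [exp x <= 1 / (1 - x)], and
    [1 / (1 - x) = 1 + x + x^2 / (1 - x)]. *)
Lemma expR_le_quadratic (x : R) : `|x| <= 2^-1 -> expR x <= 1 + x + 2 * x ^+ 2.
Proof.
move=> xh; have [xl xu] : - 2^-1 <= x /\ x <= 2^-1 by apply/andP; rewrite -ler_norml.
have Dx : 0 < 1 - x by lra.
have : 1 - x <= (expR x)^-1 by rewrite -expRN; exact: expR_ge1Dx.
move=> H; have {H} : expR x * (1 - x) <= 1.
  by rewrite -ler_pdivlMl ?expR_gt0// mulr1.
move=> H; rewrite -(ler_pM2r Dx); apply: (le_trans H).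
have -> : (1 + x + 2 * x ^+ 2) * (1 - x) = 1 + x ^+ 2 * (1 - 2 * x) by ring.
by rewrite lerDl mulr_ge0 ?sqr_ge0//; lra.
Qed.

Lemma dist_mean q f s x : stochastic q -> osc_le f s -> `|f x - mean q f| <= s.
Proof.
move=> qs fs; rewrite ler_norml; apply/andP; split.
  have : mean q f <= mean q (fun=> f x + s).
    by apply: le_mean => // y; have := fs y x; lra.
  by rewrite mean_cst//; lra.
have : mean q (fun=> f x - s) <= mean q f.
  by apply: le_mean => // y; have := fs x y; lra.
by rewrite mean_cst//; lra.
Qed.

(** After centring [f] at its mean the first-order term of the exponential
    vanishes, so the mean of the exponential lies between [1] and
    [1 + 2 (gamma s)^2]; its logarithm is of order [gamma^2] and one factor
    [gamma] is lost to the normalisation. *)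
Lemma entropic_mean gamma q f s : stochastic q -> osc_le f s ->
  `|gamma| * s <= 2^-1 ->
  `|entropic gamma q f - mean q f| <= 2 * `|gamma| * s ^+ 2.
Proof.
move=> qs fs gs; set m := mean q f.
have dm y : `|f y - m| <= s by exact: dist_mean.
rewrite /entropic; case: eqVneq => [->|g0].
  by rewrite /m subrr normr0 mulr0 mul0r.
set Z := mean q (fun y => expR (gamma * (f y - m))).
have EZ : mean q (fun y => expR (gamma * f y)) = expR (gamma * m) * Z.
  rewrite /Z /mean mulr_sumr; apply: eq_bigr => y _.
  by rewrite mulrCA -expRD; congr (_ * expR _); ring.
have m0 : mean q (fun y => f y - m) = 0.
  by rewrite -[X in mean q X]/(fun y => f y - (fun=> m) y) -meanB mean_cst// /m subrr.
have Z1 : 1 <= Z.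
  have <- : mean q (fun y => 1 + gamma * (f y - m)) = 1.
    by rewrite mean_affine// m0 mulr0 addr0.
  by apply: le_mean => // y; exact: expR_ge1Dx.
have Z2 : Z <= 1 + 2 * (gamma * s) ^+ 2.
  have <- : mean q (fun y => 1 + 2 * (gamma * s) ^+ 2 + gamma * (f y - m))
      = 1 + 2 * (gamma * s) ^+ 2 by rewrite mean_affine// m0 mulr0 addr0.
  apply: le_mean => // y.
  have xs : `|gamma * (f y - m)| <= `|gamma * s|.
    rewrite !normrM ler_wpM2l//; apply: (le_trans (dm y)); exact: ler_norm.
  apply: le_trans (expR_le_quadratic _) _.
    rewrite normrM; apply: le_trans gs; exact: ler_wpM2l.
  have : (gamma * (f y - m)) ^+ 2 <= (gamma * s) ^+ 2.
    by rewrite -real_normK ?num_real// -[leRHS]real_normK ?num_real// lerXn2r ?nnegrE.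
  lra.
have Z0 : 0 < Z by lra.
rewrite EZ lnM ?posrE ?expR_gt0// expRK mulrDr mulKf// addrAC subrr add0r.
rewrite normrM normfV mulrC ler_pdivrMr ?normr_gt0//.
have -> : 2 * `|gamma| * s ^+ 2 * `|gamma| = 2 * (gamma * s) ^+ 2.
  by rewrite exprMn -[gamma ^+ 2]real_normK ?num_real//; ring.
rewrite ger0_norm ?ln_ge0//.
apply: le_trans (_ : ln (1 + (Z - 1)) <= _); first by rewrite addrC subrK.
by apply: (le_trans (le_ln1Dx _)); lra.
Qed.

Lemma argmin_exists f (x0 : E) : exists y, forall z, f y <= f z.
Proof.
exists [arg min_(y < x0) f y]%O.
by case: arg_minP => // y _ ymin z; exact: ymin.
Qed.

(** Subtracting the minimum of [f] makes it nonnegative, and then discarding the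
    points where [q < q'] can only increase the difference of the means; what
    remains is at most [s] times the excess mass of [q] over [q'] on one set. *)
Lemma mean_contract q q' f (r s : R) : stochastic q -> stochastic q' ->
  (forall A : {set E}, \sum_(y in A) q y - \sum_(y in A) q' y <= r) ->
  osc_le f s -> mean q f - mean q' f <= r * s.
Proof.
move=> qs qs' qr fs.
have [x0 _|E0] := pickP (predT : pred E); last first.
  have := oner_neq0 R; case: qs => _ <-; rewrite big1 ?eqxx// => y.
  by have := E0 y.
have [x /= xmin] := argmin_exists f x0.
have {xmin} f0 y : 0 <= f y - f x by rewrite subr_ge0.
have -> : mean q f - mean q' f = \sum_y (q y - q' y) * (f y - f x).
  transitivity (mean q (fun y => - f x + 1 * f y) -
                mean q' (fun y => - f x + 1 * f y)).
    by rewrite !mean_affine//; ring.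
  by rewrite /mean -sumrB; apply: eq_bigr => y _; ring.
pose A : {set E} := finset (fun y => q' y <= q y).
have step : \sum_y (q y - q' y) * (f y - f x) <= \sum_(y in A) (q y - q' y) * s.
  rewrite [leRHS]big_mkcond; apply: ler_sum => y _; rewrite inE.
  case: (leP (q' y) (q y)) => qy; first by rewrite ler_wpM2l// subr_ge0.
  by rewrite nmulr_rle0 ?f0// subr_lt0.
apply: (le_trans step); rewrite -mulr_suml sumrB ler_wpM2r//.
by have := fs x x; rewrite subrr.
Qed.

End Entropic.

(** * The dynamic programming recursion *)

Section DynamicProgramming.
Variables (R : realType) (E U : finType) (p : U -> E -> E -> R).
Variables (c : E -> U -> R) (beta : R) (a0 : U).
Hypothesis hp : transition_kernel p.
Hypothesis beta01 : 0 < beta < 1.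
Implicit Types (gamma : R) (f : E -> R) (pi : policy E U).

Let hps a x : stochastic (p a x).
Proof. by case: hp => p0 p1; split; [exact: p0|exact: p1]. Qed.

Definition bellman gamma (a : U) x f : R :=
  c x a + beta * entropic (gamma * beta) (p a x) f.

(** [a0] only serves to start the search for a maximum. *)
Definition greedy gamma f x : U := [arg max_(a > a0) bellman gamma a x f]%O.

Fixpoint horizon_value k gamma x : R :=
  if k is k'.+1 then
    let f := horizon_value k' (gamma * beta) in
    bellman gamma (greedy gamma f x) x f
  else 0.

(** The reward of [pi] over [k] further steps after the history [h], discounted
    back to the last time of [h]. *)
Fixpoint policy_value pi k gamma m (h : m.+1.-tuple E) : R :=
  if k is k'.+1 then
    bellman gamma (pi m h) (tnth h ord_max)
      (fun y => policy_value pi k' (gamma * beta) [tuple of rcons h y])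
  else 0.

Lemma bellman_greedy gamma f x a :
  bellman gamma a x f <= bellman gamma (greedy gamma f x) x f.
Proof. by rewrite /greedy; case: arg_maxP => // b _ bmax; exact: bmax. Qed.

Lemma le_bellman gamma a x f g : (forall y, f y <= g y) ->
  bellman gamma a x f <= bellman gamma a x g.
Proof.
move=> fg; rewrite lerD2l ler_wpM2l ?le_entropic//.
by case/andP: beta01 => /ltW.
Qed.

Lemma tnth_rcons_max m (h : m.+1.-tuple E) y :
  tnth [tuple of rcons h y] ord_max = y.
Proof.
by rewrite (tnth_nth y) /= nth_rcons size_tuple ltnn eqxx.
Qed.

Lemma policy_value_le pi k gamma m (h : m.+1.-tuple E) :
  policy_value pi k gamma h <= horizon_value k gamma (tnth h ord_max).
Proof.
elim: k gamma m h => [|k IH] gamma m h //=.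
apply: le_trans (bellman_greedy _ _ _ _); apply: le_bellman => y.
by apply: le_trans (IH _ _ _) _; rewrite tnth_rcons_max.
Qed.

(** At time [m] the current problem has risk parameter [gamma * beta ^+ m] and
    [n - m] steps to go, one of which is the step being decided. *)
Definition greedy_policy n gamma : policy E U := fun m h =>
  greedy (gamma * beta ^+ m) (horizon_value (n - m).-1 (gamma * beta ^+ m.+1))
    (tnth h ord_max).

Lemma greedy_policy_value n gamma k m (h : m.+1.-tuple E) : (k + m = n)%N ->
  policy_value (greedy_policy n gamma) k (gamma * beta ^+ m) h =
  horizon_value k (gamma * beta ^+ m) (tnth h ord_max).
Proof.
elim: k m h => [//|k IH] m h kn.
have next_gamma : gamma * beta ^+ m * beta = gamma * beta ^+ m.+1.
  by rewrite exprSr mulrA.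
rewrite [LHS]/= [RHS]/= next_gamma.
have -> : greedy_policy n gamma h = greedy (gamma * beta ^+ m)
    (horizon_value k (gamma * beta ^+ m.+1)) (tnth h ord_max).
  by rewrite /greedy_policy -kn addSnnS -addSnnS addnK.
congr (bellman _ _ _ _); apply/funext => y.
by rewrite IH ?tnth_rcons_max// -kn addSnnS.
Qed.

Lemma horizon_attained n gamma x : exists a, horizon_value n.+1 gamma x =
  bellman gamma a x (horizon_value n (gamma * beta)).
Proof. by eexists. Qed.

Lemma horizon_bellman_le n gamma x a :
  bellman gamma a x (horizon_value n (gamma * beta)) <=
  horizon_value n.+1 gamma x.
Proof. exact: bellman_greedy. Qed.

Lemma bellman0 a x f : bellman 0 a x f = c x a + beta * mean (p a x) f.
Proof. by rewrite /bellman mul0r /entropic eqxx. Qed.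

Lemma neutral_attained n x : exists a, horizon_value n.+1 0 x =
  c x a + beta * mean (p a x) (horizon_value n 0).
Proof.
by have [a ->] := horizon_attained n 0 x; exists a; rewrite bellman0 mul0r.
Qed.

Lemma neutral_bellman_le n x a :
  c x a + beta * mean (p a x) (horizon_value n 0) <= horizon_value n.+1 0 x.
Proof.
by apply: le_trans (horizon_bellman_le n 0 x a); rewrite bellman0 mul0r.
Qed.

(** * Oscillation bounds uniform in the discount factor *)

Section Comparison.
Variables (delta C : R).
Hypothesis delta1 : delta < 1.
Hypothesis hdelta : forall a a' x x' (A : {set E}),
  \sum_(y in A) p a x y - \sum_(y in A) p a' x' y <= delta.
Hypothesis hC : forall x a, `|c x a| <= C.

Let delta0 (x : E) : 0 <= delta.
Proof. by have := hdelta a0 a0 x x (finset.set0); rewrite subrr. Qed.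

(** The bound is the fixed point of [s = 2 C + delta * s]. *)
Lemma osc_neutral n : osc_le (horizon_value n 0) (2 * C / (1 - delta)).
Proof.
case/andP: beta01 => b0 b1.
set s := 2 * C / _.
have d1 : 0 < 1 - delta by rewrite subr_gt0.
have ss : s * (1 - delta) = 2 * C by rewrite /s mulfVK// gt_eqF.
elim: n => [x y|n IH x x'].
  rewrite [horizon_value _ _ _]/= subrr /s; apply: divr_ge0; last exact: ltW.
  by apply: mulr_ge0 => //; apply: le_trans (hC x a0).
have [a ->] := neutral_attained n x.
have := neutral_bellman_le n x' a.
move: IH; set f := horizon_value n 0 => IH.
have s0 : 0 <= s by have := IH x x; rewrite subrr.
have M : mean (p a x) f - mean (p a x') f <= delta * s.
  by apply: mean_contract => // A; exact: hdelta.
have : beta * (mean (p a x) f - mean (p a x') f) <= delta * s.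
  apply: le_trans (_ : beta * (delta * s) <= _); first by rewrite ler_wpM2l// ltW.
  rewrite -[leRHS]mul1r; apply: ler_wpM2r; last exact: ltW.
  by apply: mulr_ge0 => //; exact: (delta0 x).
have /ler_normlP [_ c1] := hC x a; have /ler_normlP [c2 _] := hC x' a.
lra.
Qed.

(** [S] bounds the oscillation of the risk-sensitive value itself, as the sum of
    the neutral bound and of the inductive bound [eps] on the difference; this
    is what makes [entropic_mean] applicable at the next step. The condition on
    [gamma] says that the two entropic errors, [2 |gamma| S^2] each, fit in the
    room [(1 - delta) * eps] left by the contraction. *)
Lemma osc_compare eps n gamma (S := 2 * C / (1 - delta) + eps) : 0 < eps ->
  4 * `|gamma| * S ^+ 2 <= (1 - delta) * eps ->
  osc_le (fun x => horizon_value n gamma x - horizon_value n 0 x) eps.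
Proof.
case/andP: (beta01) => b0 b1 eps0.
elim: n gamma => [|n IH] gamma gammaS x x'.
  by rewrite /= !subr0 ltW.
(* At [x] compare through the action optimal for [gamma], at [x'] through the
   one optimal for [0]: both choices bound the difference from above. *)
have [a ->] := horizon_attained n gamma x.
have [a' ->] := neutral_attained n x'.
have := neutral_bellman_le n x a; have := horizon_bellman_le n gamma x' a'.
have betaS : 4 * `|gamma * beta| * S ^+ 2 <= (1 - delta) * eps.
  apply: le_trans gammaS; rewrite ler_wpM2r ?sqr_ge0// ler_pM2l//.
  by rewrite normrM (gtr0_norm b0) ler_piMr// ltW.
have := osc_neutral n; have := IH _ betaS.
set f := horizon_value n (gamma * beta); set g := horizon_value n 0 => fg gs.
clearbody f g.
have fS : osc_le f S.
  by move=> y z; rewrite /S; have := fg y z; have := gs y z; lra.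
have S_eps : eps <= S by rewrite lerDr; have := gs x x; rewrite subrr.
have S0 : 0 < S by lra.
have d0 := delta0 x; have d1 := delta1.
(* Dividing the hypothesis on [gamma] by [S], using [eps <= S]. *)
have small : `|gamma * beta| * S <= 2^-1.
  have : 4 * `|gamma * beta| * S <= 1.
    rewrite -(ler_pM2r S0) mul1r.
    apply: le_trans (_ : 4 * `|gamma * beta| * S ^+ 2 <= _).
      by rewrite expr2 [leRHS]mulrA.
    apply: le_trans betaS _.
    by apply: le_trans S_eps; apply: ler_piMl; [exact: ltW | lra].
  lra.
have /ler_normlP [_ e1] := entropic_mean (hps a x) fS small.
have /ler_normlP [e2 _] := entropic_mean (hps a' x') fS small.
have contr : mean (p a x) (fun y => f y - g y) -
    mean (p a' x') (fun y => f y - g y) <= delta * eps.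
  by apply: mean_contract => // A; exact: hdelta.
have : beta * (entropic (gamma * beta) (p a x) f - mean (p a x) g -
    (entropic (gamma * beta) (p a' x') f - mean (p a' x') g)) <= eps.
  apply: le_trans (_ : beta * eps <= _); last by apply: ler_piMl; exact: ltW.
  rewrite ler_pM2l//; move: contr; rewrite -!meanB; lra.
rewrite /bellman; lra.
Qed.

End Comparison.

End DynamicProgramming.

(** * Certainty equivalents of bounded random variables *)

Section CertaintyEquivalent.
Variables (R : realType) (d : measure_display) (Omega : measurableType d).
Variable P : probability Omega R.
Implicit Types (Y Z : Omega -> R) (M e : R).

Definition certainty_equiv (gamma : R) Y : R :=
  if gamma == 0 then fine 'E_P[Y]%E
  else gamma^-1 * ln (fine ('E_P[fun w => expR (gamma * Y w)])%E).

Lemma bounded_integrable Y M : measurable_fun setT Y ->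
  (forall w, `|Y w| <= M) -> P.-integrable setT (EFin \o Y).
Proof.
move=> mY YM; apply: measurable_bounded_integrable => //.
  by rewrite (le_lt_trans (probability_le1 _ _))// ltry.
exists M; split; first exact: num_real.
by move=> M' MM' w _; apply: le_trans (YM w) (ltW MM').
Qed.

Lemma Rintegral_constant (r : R) : \int[P]_w r = r.
Proof.
rewrite Rintegral_cst// -[RHS]mulr1; congr (_ * _).
by rewrite [X in fine X]probability_setT.
Qed.

Lemma exp_integrable gamma Y M : measurable_fun setT Y ->
  (forall w, `|Y w| <= M) ->
  P.-integrable setT (EFin \o (fun w => expR (gamma * Y w))).
Proof.
move=> mY YM; apply: (@bounded_integrable _ (expR (`|gamma| * M))).
  apply: measurableT_comp => //; exact: measurable_funM.
move=> w; rewrite ger0_norm ?expR_ge0// ler_expR (le_trans (ler_norm _))//.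
by rewrite normrM ler_wpM2l.
Qed.

(** Certainty equivalents are monotone and commute with adding a constant, which
    makes them 1-Lipschitz for the uniform distance. *)
Lemma certainty_equiv_le gamma Y Z e M :
  measurable_fun setT Y -> measurable_fun setT Z ->
  (forall w, `|Y w| <= M) -> (forall w, `|Z w| <= M) ->
  (forall w, Y w <= Z w + e) ->
  certainty_equiv gamma Y <= certainty_equiv gamma Z + e.
Proof.
move=> mY mZ YM ZM YZ; rewrite /certainty_equiv unlock.
have mZe : measurable_fun setT (fun w => Z w + e) by exact: measurable_funD.
have ZeM w : `|Z w + e| <= M + `|e|.
  by apply: le_trans (ler_normD _ _) _; rewrite lerD2r.
case: eqVneq => [_|g0].
  have -> : fine (\int[P]_w (Z w)%:E) + e = \int[P]_w (Z w + e).
    rewrite RintegralD//; last 2 first.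
    - exact: (bounded_integrable mZ ZM).
    - exact: (@bounded_integrable _ `|e|).
    by rewrite Rintegral_constant.
  apply: le_Rintegral => //.
  - exact: (bounded_integrable mY YM).
  - exact: (bounded_integrable mZe ZeM).
have iY := exp_integrable gamma mY YM.
have iZ := exp_integrable gamma mZ ZM.
have iZe := exp_integrable gamma mZe ZeM.
have pos (V : Omega -> R) (K : R) : measurable_fun setT V -> (forall w, `|V w| <= K) ->
    0 < \int[P]_w expR (gamma * V w).
  move=> mV VK; apply: lt_le_trans (expR_gt0 (- (`|gamma| * K))) _.
  have -> : expR (- (`|gamma| * K)) = \int[P]_w (expR (- (`|gamma| * K))).
    by rewrite Rintegral_constant.
  apply: le_Rintegral => //.
  - exact: (@bounded_integrable _ `|expR (- (`|gamma| * K))|).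
  - exact: (exp_integrable gamma mV VK).
  - move=> w _; rewrite ler_expR lerNl.
    apply: le_trans (ler_norm _) _; rewrite normrN normrM ler_wpM2l//.
have shift : \int[P]_w expR (gamma * (Z w + e)) =
    \int[P]_w expR (gamma * Z w) * expR (gamma * e).
  by rewrite -RintegralZr//; apply: eq_Rintegral => w _; rewrite -expRD mulrDr.
have -> : gamma^-1 * ln (fine (\int[P]_w (expR (gamma * Z w))%:E)) + e =
    gamma^-1 * ln (\int[P]_w expR (gamma * (Z w + e))).
  rewrite shift lnM ?posrE ?expR_gt0//; last exact: pos mZ ZM.
  by rewrite expRK mulrDr mulKf.
apply: ler_ln_scale => //.
- exact: pos mY YM.
- exact: pos mZe ZeM.
- by move=> gp; apply: le_Rintegral => // w _; rewrite ler_expR ler_pM2l.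
- by move=> gn; apply: le_Rintegral => // w _; rewrite ler_expR ler_nM2l.
Qed.

End CertaintyEquivalent.

(** * The law of the controlled process *)

Section Process.
Variables (R : realType) (E U : finType) (p : U -> E -> E -> R).
Variables (c : E -> U -> R) (d : measure_display) (Omega : measurableType d).
Variables (X : nat -> Omega -> E) (Pr : policy E U -> E -> probability Omega R).
Hypothesis hp : transition_kernel p.
Hypothesis hX : controlled_process p X Pr.
Variable beta : R.
Implicit Types (pi : policy E U).

Lemma history_rcons n w :
  history X n.+1 w = [tuple of rcons (history X n w) (X n.+1 w)].
Proof.
apply: eq_from_tnth => i; rewrite tnth_mktuple (tnth_nth (X 0%N w)) /=.
rewrite nth_rcons size_map size_enum_ord.
have := ltn_ord i; rewrite ltnS leq_eqVlt => /orP[/eqP ->|iltn].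
  by rewrite ltnn eqxx.
rewrite iltn (nth_map (Ordinal iltn)) ?size_enum_ord//.
by have /= -> := nth_ord_enum (Ordinal iltn) (Ordinal iltn).
Qed.

Lemma history_last n w : tnth (history X n w) ord_max = X n w.
Proof. by rewrite tnth_mktuple. Qed.

Lemma history_rcons_preimage n (h : n.+1.-tuple E) y :
  history X n.+1 @^-1` [set [tuple of rcons h y]] =
  history X n @^-1` [set h] `&` X n.+1 @^-1` [set y].
Proof.
apply/seteqP; split => w /=; rewrite history_rcons.
  by move=> /(congr1 val)/rcons_inj[hw ->]; split => //; exact: val_inj.
by move=> [-> ->].
Qed.

Lemma measurable_history n (h : n.+1.-tuple E) :
  measurable (history X n @^-1` [set h]).
Proof.
rewrite (_ : _ @^-1` _ = \bigcap_(i in [set: 'I_n.+1]) X i @^-1` [set tnth h i]).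
  apply: fin_bigcap_measurable => // i _; exact: (process_measurable hX).
apply/seteqP; split => w /=.
  by move=> <- i _ /=; rewrite tnth_mktuple.
by move=> hw; apply: eq_from_tnth => i; rewrite tnth_mktuple; exact: hw.
Qed.

Lemma measurable_history_fun n (g : n.+1.-tuple E -> R) :
  measurable_fun setT (fun w => g (history X n w)).
Proof.
move=> _ B mB; rewrite setTI.
rewrite (_ : _ @^-1` _ = \bigcup_(h in g @^-1` B) history X n @^-1` [set h]).
  by apply: fin_bigcup_measurable => // h _; exact: measurable_history.
apply/seteqP; split => w /=.
  by move=> Bw; exists (history X n w).
by move=> [h Bh /= ->].
Qed.

Definition partial_reward pi m k w : R :=
  \sum_(i < k) beta ^+ i * c (X (m + i)%N w) (action X pi (m + i)%N w).

Lemma partial_rewardS pi m k w : partial_reward pi m k.+1 w =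
  c (X m w) (action X pi m w) + beta * partial_reward pi m.+1 k w.
Proof.
rewrite /partial_reward big_ord_recl /= addn0 expr0 mul1r mulr_sumr.
congr (_ + _); apply: eq_bigr => i _.
by rewrite /bump /= add1n -addSnnS exprS mulrA.
Qed.

Lemma measurable_partial_reward pi m k :
  measurable_fun setT (partial_reward pi m k).
Proof.
apply: measurable_sum => i.
pose g (h : (m + i).+1.-tuple E) := beta ^+ i * c (tnth h ord_max) (pi _ h).
rewrite (_ : (fun w => _) = (fun w => g (history X (m + i) w))).
  exact: measurable_history_fun.
by apply/funext => w; rewrite /g history_last.
Qed.

(** The conditional expectation of [phi] of the reward collected in the [k] steps
    after the history [h]. The function [phi] is updated along the recursion so
    that the same definition serves the identity and the exponentials. *)
Fixpoint reward_mean pi k m (h : m.+1.-tuple E) (phi : R -> R) : R :=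
  if k is k'.+1 then
    mean (p (pi m h) (tnth h ord_max)) (fun y =>
      reward_mean pi k' [tuple of rcons h y]
        (fun r => phi (c (tnth h ord_max) (pi m h) + beta * r)))
  else phi 0.

Lemma integral_history_split pi x m (h : m.+1.-tuple E) (f : Omega -> R) :
  measurable_fun setT f ->
  (\int[Pr pi x]_(w in history X m @^-1` [set h]) (f w)%:E =
   \sum_y \int[Pr pi x]_(w in history X m.+1 @^-1` [set [tuple of rcons h y]])
     (f w)%:E)%E.
Proof.
move=> mf.
have -> : history X m @^-1` [set h] = \big[setU/set0]_(y <- index_enum E)
    history X m.+1 @^-1` [set [tuple of rcons h y]].
  rewrite -bigcup_seq; apply/seteqP; split => w /=.
    by move=> hw; exists (X m.+1 w); rewrite /= ?mem_index_enum// history_rcons hw.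
  by move=> [y _]; rewrite history_rcons_preimage => -[].
rewrite integral_bigsetU_EFin//.
- by move=> y; exact: measurable_history.
- exact: index_enum_uniq.
- apply/trivIsetP => y z _ _ yz; apply/seteqP; split => w //.
  rewrite !history_rcons_preimage => -[[_ /= wy] [_ /= wz]].
  by rewrite -wy -wz eqxx in yz.
- by apply/measurable_EFinP; apply: measurable_funTS.
Qed.

(** Splitting the event along the next state uses up one transition probability
    per step; on each piece the first reward is a constant, absorbed in [phi].
    The product form remains valid for histories of probability zero. *)
Lemma integral_reward pi x k m (h : m.+1.-tuple E) (phi : R -> R) :
  measurable_fun setT phi ->
  (\int[Pr pi x]_(w in history X m @^-1` [set h])
     (phi (partial_reward pi m k w))%:E =
   Pr pi x (history X m @^-1` [set h]) * (reward_mean pi k h phi)%:E)%E.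
Proof.
elim: k m h phi => [|k IH] m h phi mphi.
  rewrite (eq_integral (cst (phi 0)%:E)); last first.
    by move=> w _; rewrite /partial_reward big_ord0.
  rewrite integral_cst; [exact: muleC | exact: measurable_history].
rewrite integral_history_split; last first.
  exact: measurableT_comp mphi (measurable_partial_reward _ _ _).
pose phi' r := phi (c (tnth h ord_max) (pi m h) + beta * r).
have mphi' : measurable_fun setT phi'.
  exact: measurableT_comp mphi (measurable_funD _ _).
have step y : (\int[Pr pi x]_(w in history X m.+1 @^-1` [set [tuple of rcons h y]])
     (phi (partial_reward pi m k.+1 w))%:E =
   Pr pi x (history X m @^-1` [set h]) *
     (p (pi m h) (tnth h ord_max) y *
        reward_mean pi k [tuple of rcons h y] phi')%:E)%E.
  rewrite EFinM muleA -(process_transition hX) -history_rcons_preimage -IH//.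
  apply: eq_integral => w; rewrite inE history_rcons_preimage => -[/= hw _].
  by rewrite partial_rewardS /action hw -[X m w]history_last hw.
rewrite (eq_bigr _ (fun y _ => step y)).
set D := history X m @^-1` [set h].
have -> : Pr pi x D = (fine (Pr pi x D))%:E.
  by rewrite fineK// fin_num_measure//; exact: measurable_history.
rewrite /= /mean -EFinM mulr_sumr -sumEFin.
by apply: eq_bigr => y _.
Qed.

Lemma reward_mean_affine pi k m (h : m.+1.-tuple E) a b (phi : R -> R) :
  reward_mean pi k h (fun r => a + b * phi r) = a + b * reward_mean pi k h phi.
Proof.
elim: k m h phi => [//|k IH] m h phi; rewrite /= -mean_affine; last first.
  by case: hp.
by congr mean; apply/funext => y; rewrite (IH _ _ (fun r => phi (_ + beta * r))).
Qed.

Lemma reward_mean_id pi k m (h : m.+1.-tuple E) :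
  reward_mean pi k h id = policy_value p c beta pi k 0 h.
Proof.
elim: k m h => [//|k IH] m h; rewrite /= bellman0 mul0r -mean_affine; last first.
  by case: hp.
congr mean; apply/funext => y; rewrite -IH.
exact: (reward_mean_affine _ _ _ _ _ id).
Qed.

(** The first reward factors out of the exponential and the remaining reward is
    discounted by [beta], so the exponent for the tail is [gamma * beta]. *)
Lemma reward_mean_exp pi k gamma m (h : m.+1.-tuple E) :
  gamma != 0 -> beta != 0 ->
  reward_mean pi k h (fun r => expR (gamma * r)) =
  expR (gamma * policy_value p c beta pi k gamma h).
Proof.
move=> g0 b0; elim: k gamma g0 m h => [//|k IH] gamma g0 m h /=.
have gb0 : gamma * beta != 0 by rewrite mulf_neq0.
set a := pi m h; set z := tnth h ord_max.
set f := fun y => policy_value p c beta pi k (gamma * beta) [tuple of rcons h y].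
have hs : stochastic (p a z) by case: hp.
rewrite /bellman /entropic (negPf gb0).
set Z := mean _ (fun y => expR (gamma * beta * f y)).
have Z0 : 0 < Z by apply: mean_gt0 => // y; exact: expR_gt0.
have -> : gamma * (c z a + beta * ((gamma * beta)^-1 * ln Z)) =
    gamma * c z a + ln Z by field; rewrite g0 b0.
rewrite expRD lnK ?posrE// -[RHS]add0r -mean_affine//.
congr mean; apply/funext => y; rewrite -IH// -reward_mean_affine.
congr reward_mean; apply/funext => r.
by rewrite add0r -expRD mulrDr mulrA.
Qed.

Lemma certainty_equiv_partial pi x k gamma : beta != 0 ->
  certainty_equiv (Pr pi x) gamma (partial_reward pi 0 k) =
  policy_value p c beta pi k gamma [tuple x].
Proof.
move=> b0.
have key phi : measurable_fun setT phi ->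
    (\int[Pr pi x]_w (phi (partial_reward pi 0 k w))%:E =
      (reward_mean pi k [tuple x] phi)%:E)%E.
  move=> mphi; have H1 : Pr pi x (history X 0 @^-1` [set [tuple x]]) = 1%:E.
    rewrite -(process_initial hX pi x); congr (Pr pi x _).
    apply/seteqP; split => w /=.
      by move=> /(congr1 (fun t => tnth t ord_max)); rewrite history_last.
    move=> Xw; apply: eq_from_tnth => i; rewrite tnth_mktuple.
    by rewrite (ord1 i).
  have mh : measurable (history X 0 @^-1` [set [tuple x]]).
    exact: measurable_history.
  have mf : measurable_fun setT (fun w => phi (partial_reward pi 0 k w)).
    exact: measurableT_comp mphi (measurable_partial_reward _ _ _).
  have := integral_reward pi x k [tuple x] mphi; rewrite H1 mul1e => <-.
  (* The process starts in [x] only almost surely. *)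
  set A := history X 0 @^-1` _.
  rewrite -(setvU A) integral_setU//; last 3 first.
  - exact: measurableC.
  - by apply/measurable_EFinP; exact: measurable_funTS.
  - by apply/disj_set2P; rewrite setICl.
  rewrite null_set_integral ?add0e//; first exact: measurableC.
    by apply/measurable_EFinP; exact: measurable_funTS.
  by apply: etrans (probability_setC (Pr pi x) mh) _; rewrite H1 subee.
rewrite /certainty_equiv unlock; case: eqVneq => [->|g0].
  by rewrite (key id)//= reward_mean_id.
rewrite (key (fun r => expR (gamma * r))); last first.
  apply: measurableT_comp => //; exact: measurable_funM.
by rewrite /= reward_mean_exp// expRK mulKf.
Qed.

End Process.

(** * Discounted sums and the infinite horizon *)

Section GeometricTail.
Variables (R : realType) (u : nat -> R) (C beta : R).
Hypothesis beta01 : 0 < beta < 1.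
Hypothesis uC : forall i, `|u i| <= C * beta ^+ i.

Let tail n := C * beta ^+ n / (1 - beta).

Lemma cvg_geometric_bounded : cvgn (series u).
Proof.
apply: normed_cvg; apply: (series_le_cvg _ _ uC) => //.
- by move=> n; apply: le_trans (uC n).
- apply: is_cvg_geometric_series; case/andP: beta01 => b0 b1.
  by rewrite ger0_norm// ltW.
Qed.

Lemma lim_series_tail n : `|limn (series u) - series u n| <= tail n.
Proof.
case/andP: (beta01) => b0 b1.
have d0 : 0 < 1 - beta by rewrite subr_gt0.
have tailS k : tail k - tail k.+1 = C * beta ^+ k.
  by rewrite /tail exprSr; field; rewrite gt_eqF.
have tail0 k : 0 <= tail k.
  by rewrite divr_ge0 ?(ltW d0)//; apply: le_trans (uC k).
have partial j : `|series u (n + j)%N - series u n| <= tail n - tail (n + j)%N.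
  elim: j => [|j IH]; first by rewrite addn0 !subrr normr0.
  have := uC (n + j)%N; rewrite -tailS addnS seriesSr => uj.
  have -> : series u (n + j)%N + u (n + j)%N - series u n =
    (series u (n + j)%N - series u n) + u (n + j)%N by ring.
  apply: le_trans (ler_normD _ _) _; lra.
have near_tail : \forall m \near \oo, `|series u m - series u n| <= tail n.
  near=> m; have nm : (n <= m)%N by near: m; exact: nbhs_infty_ge.
  have := partial (m - n)%N; rewrite subnKC//; have := tail0 m; lra.
rewrite ler_distl; apply/andP; split.
  apply: limr_ge; first exact: cvg_geometric_bounded.
  by apply: filterS near_tail => m; rewrite ler_distl => /andP[].
apply: limr_le; first exact: cvg_geometric_bounded.
by apply: filterS near_tail => m; rewrite ler_distl => /andP[].
Unshelve. all: by end_near.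
Qed.

End GeometricTail.

(** * From the finite horizon to the value functions *)

Section Value.
Variables (R : realType) (E U : finType) (p : U -> E -> E -> R).
Variables (c : E -> U -> R) (d : measure_display) (Omega : measurableType d).
Variables (X : nat -> Omega -> E) (Pr : policy E U -> E -> probability Omega R).
Hypothesis hp : transition_kernel p.
Hypothesis hX : controlled_process p X Pr.
Variables (beta C : R) (a0 : U).
Hypothesis beta01 : 0 < beta < 1.
Hypothesis hC : forall x a, `|c x a| <= C.
Implicit Types (pi : policy E U).

Lemma valueE gamma x : value c X Pr beta gamma x =
  sup [set certainty_equiv (Pr pi x) gamma (total_reward c X beta pi)
      | pi in [set: policy E U]].
Proof. by rewrite /value /certainty_equiv; case: ifP. Qed.

Lemma partial_reward_series pi n w : partial_reward c X beta pi 0 n w =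
  series (fun i => beta ^+ i * c (X i w) (action X pi i w)) n.
Proof. by rewrite /series /= big_mkord. Qed.

Let reward_le pi w i :
  `|beta ^+ i * c (X i w) (action X pi i w)| <= C * beta ^+ i.
Proof.
case/andP: beta01 => b0 _.
have bi : 0 <= beta ^+ i by apply: exprn_ge0; exact: ltW.
by rewrite normrM (ger0_norm bi) mulrC; apply: ler_wpM2r.
Qed.

Lemma total_reward_tail pi n w :
  `|total_reward c X beta pi w - partial_reward c X beta pi 0 n w| <=
  C * beta ^+ n / (1 - beta).
Proof. by rewrite partial_reward_series; exact: lim_series_tail. Qed.

Lemma measurable_total_reward pi :
  measurable_fun setT (total_reward c X beta pi).
Proof.
apply: (@measurable_fun_cvg _ _ _ _ (partial_reward c X beta pi 0)).
  by move=> n; exact: (measurable_partial_reward c hX).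
move=> w _; under eq_fun do rewrite partial_reward_series.
exact: (cvg_geometric_bounded beta01 (reward_le pi w)).
Qed.

Lemma certainty_equiv_tail pi x n gamma :
  `|certainty_equiv (Pr pi x) gamma (total_reward c X beta pi) -
    policy_value p c beta pi n gamma [tuple x]| <= C * beta ^+ n / (1 - beta).
Proof.
case/andP: (beta01) => b0 b1.
rewrite -(certainty_equiv_partial c hp hX) ?gt_eqF//.
set e := C * beta ^+ n / (1 - beta).
set T := total_reward c X beta pi; set S := partial_reward _ _ _ _ _ _.
have mT : measurable_fun setT T := measurable_total_reward pi.
have mS : measurable_fun setT S by exact: (measurable_partial_reward c hX).
have TS w : `|T w - S w| <= e by exact: total_reward_tail.
pose M := C / (1 - beta) + e.
have e0 : 0 <= e by apply: le_trans (TS point).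
have TM w : `|T w| <= C / (1 - beta).
  have := total_reward_tail pi 0 w; rewrite expr0 mulr1.
  by rewrite /partial_reward big_ord0 subr0.
have SM w : `|S w| <= M.
  rewrite -(subrK (T w) (S w)) addrC; apply: le_trans (ler_normD _ _) _.
  by rewrite lerD// distrC.
have {}TM w : `|T w| <= M by apply: le_trans (TM w) _; rewrite lerDl.
rewrite ler_distlC; apply/andP; split.
  rewrite lerBlDr; apply: (certainty_equiv_le _ _ mT mS TM SM) => w.
  by have /ler_normlP [] := TS w; lra.
apply: (certainty_equiv_le _ _ mS mT SM TM) => w.
by have /ler_normlP [] := TS w; lra.
Qed.

(** Truncation changes the certainty equivalent of every policy by at most the
    tail of a geometric series, and the greedy policy attains the finite-horizon
    optimum. *)
Lemma value_horizon n gamma x :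
  `|value c X Pr beta gamma x - horizon_value p c beta a0 n gamma x| <=
  C * beta ^+ n / (1 - beta).
Proof.
set e := _ / _; rewrite valueE; set A := [set _ | _ in _].
have A_ub : ubound A (horizon_value p c beta a0 n gamma x + e).
  move=> _ [pi _ <-].
  have := policy_value_le c a0 hp beta01 pi n gamma [tuple x].
  rewrite [tnth _ _]/=.
  have := certainty_equiv_tail pi x n gamma; rewrite -/e.
  by move=> /ler_normlP [_]; lra.
rewrite ler_distl; apply/andP; split; last first.
  apply: ge_sup => //; eexists; exists (fun _ _ => a0) => //.
rewrite lerBlDr.
pose pi := greedy_policy p c beta a0 n gamma.
have := greedy_policy_value p c beta a0 gamma [tuple x] (addn0 n).
rewrite expr0 mulr1 [tnth _ _]/= => <-.
have /ler_normlP [+ _] := certainty_equiv_tail pi x n gamma; rewrite -/e.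
have : certainty_equiv (Pr pi x) gamma (total_reward c X beta pi) <= sup A.
  apply: ub_le_sup; first by exists (horizon_value p c beta a0 n gamma x + e).
  by exists pi.
by rewrite -/pi; lra.
Qed.

Lemma osc_value delta eps gamma (S := 2 * C / (1 - delta) + eps) :
  delta < 1 ->
  (forall a a' x x' (A : {set E}),
    \sum_(y in A) p a x y - \sum_(y in A) p a' x' y <= delta) ->
  0 < eps -> 4 * `|gamma| * S ^+ 2 <= (1 - delta) * eps ->
  osc_le (fun x => value c X Pr beta gamma x - value c X Pr beta 0 x) eps.
Proof.
move=> d1 hd eps0 gS x y; case/andP: (beta01) => b0 b1.
pose e n := C * beta ^+ n / (1 - beta).
have e_cvg : e @ \oo --> 0.
  rewrite (_ : e = geometric (C / (1 - beta)) beta).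
    by apply: cvg_geometric; rewrite ger0_norm// ltW.
  by apply/funext => n; rewrite /e /= mulrAC.
have le_e n : value c X Pr beta gamma x - value c X Pr beta 0 x -
    (value c X Pr beta gamma y - value c X Pr beta 0 y) <= eps + 4 * e n.
  have /ler_normlP [_] := value_horizon n gamma x.
  have /ler_normlP [+ _] := value_horizon n 0 x.
  have /ler_normlP [+ _] := value_horizon n gamma y.
  have /ler_normlP [_] := value_horizon n 0 y.
  have := osc_compare a0 hp beta01 d1 hd hC n eps0 gS x y.
  rewrite -/(e n); lra.
have : eps + 4 * e n @[n --> \oo] --> eps.
  rewrite -[X in _ --> X]addr0 -(mulr0 4).
  by apply: cvgD; [exact: cvg_cst | apply: cvgM => //; exact: cvg_cst].
move=> lim_eps; rewrite -(cvg_lim _ lim_eps)//.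
apply: limr_ge; first by apply/cvg_ex; exists eps.
exact: nearW.
Qed.

End Value.

Lemma Delta_bar_ge (R : realType) (E U : finType) (p : U -> E -> E -> R)
    (hp : transition_kernel p) a a' x x' (A : {set E}) :
  \sum_(y in A) p a x y - \sum_(y in A) p a' x' y <= Delta_bar p.
Proof.
have bnd b z (B : {set E}) : 0 <= trans_prob p b z B <= 1.
  case: hp => p0 p1; rewrite sumr_ge0//= -(p1 b z) [leRHS](bigID (mem B))/=.
  by rewrite lerDl sumr_ge0.
apply: le_trans (ler_norm _) _; apply: ub_le_sup; last by exists x, x', A, a, a'.
exists 1 => _ [z [z' [B [b [b' ->]]]]].
have /andP[? ?] := bnd b z B; have /andP[? ?] := bnd b' z' B.
by rewrite ler_norml; apply/andP; split; lra.
Qed.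

Lemma span_seminorm_bounds (R : realType) (E : finType) (f : E -> R) s (x : E) :
  osc_le f s -> 0 <= span_seminorm f <= s.
Proof.
move=> fs; apply/andP; split.
  apply: ub_le_sup; last by exists (x, x); rewrite //= subrr.
  by exists s => _ [[y z] _ <-]; exact: fs.
apply: ge_sup; first by exists (f x - f x); exists (x, x).
by move=> _ [[y z] _ <-]; exact: fs.
Qed.

Theorem proposition6p5 (R : realType) (E U : finType)
  (hE : (0 < #|E|)%N) (hU : (0 < #|U|)%N)
  (p : U -> E -> E -> R) (hp : transition_kernel p)
  (c : E -> U -> R)
  (d : measure_display) (Omega : measurableType d) (X : nat -> Omega -> E)
  (Pr : policy E U -> E -> probability Omega R)
  (hX : controlled_process p X Pr)
  (hA1 : assumption_A1 p) (hA2 : assumption_A2 X Pr) :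
  ereal_sup [set (span_seminorm
                    (fun x => value c X Pr beta gamma x - value c X Pr beta 0 x))%:E
            | beta in [set beta : R | 0 < beta < 1]]
    @[gamma --> (0 : R)^'] --> 0%E.
Proof.
have /card_gt0P [x0 _] := hE; have /card_gt0P [a0 _] := hU.
pose C := \sum_x \sum_a `|c x a|.
have hC x a : `|c x a| <= C.
  rewrite /C (bigD1 x)//= (bigD1 a)//= -addrA lerDl addr_ge0 ?sumr_ge0// => y _.
  exact: sumr_ge0.
have C0 : 0 <= C by apply: le_trans (hC x0 a0).
set delta := Delta_bar p in hA1; have d0 : 0 < 1 - delta by rewrite subr_gt0.
set F := fun gamma : R => ereal_sup _.
have F_small eps : 0 < eps -> \forall gamma \near (0 : R)^', (0 <= F gamma <= eps%:E)%E.
  move=> eps0; pose S := 2 * C / (1 - delta) + eps.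
  have S0 : 0 < S by rewrite ltr_wpDl// divr_ge0 ?mulr_ge0// ltW.
  have g0 : 0 < (1 - delta) * eps / (4 * S ^+ 2).
    by rewrite divr_gt0 ?mulr_gt0// exprn_gt0.
  near=> gamma.
  have gS : 4 * `|gamma| * S ^+ 2 <= (1 - delta) * eps.
    rewrite mulrAC mulrC -ler_pdivlMr ?mulr_gt0 ?exprn_gt0//.
    by near: gamma; exact: dnbhs0_le.
  have bounds beta : 0 < beta < 1 -> 0 <= span_seminorm
      (fun x => value c X Pr beta gamma x - value c X Pr beta 0 x) <= eps.
    move=> b01; apply: (span_seminorm_bounds x0).
    exact: (osc_value hp hX a0 b01 hC hA1 (Delta_bar_ge hp) eps0 gS).
  apply/andP; split.
    have half : 0 < (2^-1 : R) < 1 by lra.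
    apply: le_trans (ereal_sup_ubound _); last by exists 2^-1.
    by rewrite lee_fin; case/andP: (bounds _ half).
  apply: ge_ereal_sup => _ [beta b01 <-]; rewrite lee_fin.
  by case/andP: (bounds _ b01).
apply/fine_cvgP; split.
  apply: filterS (F_small _ ltr01) => gamma /andP[F0 F1].
  by rewrite ge0_fin_numE// (le_lt_trans F1)// ltry.
apply/cvgrPdist_le => eps eps0; apply: filterS (F_small _ eps0) => gamma.
rewrite /= sub0r normrN; case: (F gamma) => [r| |] //=.
  by rewrite !lee_fin => /andP[r0 r1]; rewrite ger0_norm.
by rewrite normr0 ltW.
Unshelve. all: by end_near.
Qed.
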